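(* Let $X$ be a set, let $m\ge 2$ be an integer, and let $g_1,\ldots,g_m\in\Omega_m(X)$. Then $\{g_1,\ldots,g_m\}$ is a set of orthogonal $m$-ary operations if and only if the map \[\Omega_m(X)\to\Omega_m(X),\qquad f\mapsto\odot_f(g_1,\ldots,g_m)\] is a bijection.
   Context: $\Omega_m(X)$ is the set of all $m$-ary operations $X^m\to X$. For $f,g_1,\ldots,g_m\in\Omega_m(X)$, the operation $\odot_f(g_1,\ldots,g_m)\in\Omega_m(X)$ is defined by $\odot_f(g_1,\ldots,g_m)(\overline a):=f(g_1(\overline a),\ldots,g_m(\overline a))$ for all $\overline a\in X^m$. $\{g_1,\ldots,g_m\}\subseteq\Omega_m(X)$ is a set of orthogonal $m$-ary operations if the map $X^m\to X^m$, $\overline a\mapsto(g_1(\overline a),\ldots,g_m(\overline a))$ is a bijection. *)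

(* Defs.v *)
From mathcomp Require Import all_boot.

Set Implicit Arguments.
Unset Strict Implicit.
Unset Printing Implicit Defensive.

Definition operation (m : nat) (X : Type) : Type := m.-tuple X -> X.

Definition eval_family (m : nat) (X : Type) (g : 'I_m -> operation m X)
  (a : m.-tuple X) : m.-tuple X := [tuple g i a | i < m].

Definition odot (m : nat) (X : Type) (f : operation m X)
  (g : 'I_m -> operation m X) : operation m X := fun a => f [tuple g i a | i < m].

(* Orthogonality is a property of the indexed family: the g i are not
   required a priori to be pairwise distinct. *)
Definition orthogonal_operations (m : nat) (X : Type)
  (g : 'I_m -> operation m X) : Prop := bijective (eval_family g).

(* Main.v *)
Require Import Defs.
From mathcomp Require Import all_boot.
From Stdlib Require Import FunctionalExtensionality.

(* Writing G for the map a |-> (g_1 a, ..., g_m a), the map of the theorem is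
   precomposition with G. Lifting the projections along it yields F with
   F o G = id; then p_i o G o F and p_i have the same image p_i o G, so
   injectivity gives G o F = id. *)
Theorem lemma3p10 (X : Type) (m : nat) (hm : 2 <= m)
  (g : 'I_m -> operation m X) :
  orthogonal_operations g <-> bijective (fun f : operation m X => odot f g).
Proof.
split=> [[F GK FK] | bij_odot].
  (* Precomposition reverses composites: its left cancellation law comes from [FK], its right one
     from [GK]. *)
  exists (fun f a => f (F a)) => f; apply: functional_extensionality => a.
    by congr (f _); apply: FK.
  by congr (f _); apply: GK.
have odot_inj := bij_inj bij_odot.
have [lift _ liftK] := bij_odot.
(* Coordinate [i] of [F] is the operation that [odot] sends to the [i]-th projection. *)
pose F (b : m.-tuple X) := [tuple lift (fun a => tnth a i) b | i < m].
have GK : cancel (eval_family g) F.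
  move=> a; apply: eq_from_tnth => i; rewrite tnth_mktuple.
  exact: (congr1 (fun h => h a) (liftK (fun b => tnth b i))).
exists F => // b; apply: eq_from_tnth => i.
(* Injectivity compares whole operations, so the claim at [b] is first freed from [b]; precomposing
   then leaves only points in the image of G, where [GK] applies. *)
suff /(congr1 (fun h => h b)) : (fun c => tnth (eval_family g (F c)) i)
  = (fun c => tnth c i) :> operation m X by [].
apply: odot_inj; apply: functional_extensionality => a.
exact: (congr1 (fun c => tnth (eval_family g c) i) (GK a)).
Qed.
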